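(* Let $X$ be a locally compact space. Then $$\mu\big(\mathcal T_C(X)\big)=\mathcal Z(X^* )\setminus\{\emptyset\}.$$
   Context: Locally compact spaces and compact spaces are assumed Hausdorff. For a Tychonoff space $X$, a one-point extension of $X$ is a Tychonoff space $Y$ containing $X$ as a dense subspace such that $Y\setminus X$ is a singleton; we write $Y=X\cup\{p\}$. Two extensions are identified if there is a homeomorphism between them fixing $X$ pointwise. $\mathcal T(X)$ is the set of all (equivalence classes of) one-point extensions of $X$, and $\mathcal T_C(X)=\{Y\in\mathcal T(X): Y\text{ is Čech-complete}\}$. $\beta X$ is the Stone-Čech compactification of $X$ and $X^*=\beta X\setminus X$. $\mathcal Z(T)$ is the set of all zero-sets of a space $T$. For $Y=X\cup\{p\}\in\mathcal T(X)$, $F_Y:\beta X\to\beta Y$ is the unique continuous function with $F_Y|X=\mathrm{id}_X$, and $\mu(Y)=F_Y^{-1}(p)$, a non-empty closed subset of $X^*$. *)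

(* Defs.v *)
From HB Require Import structures.
From mathcomp Require Import all_boot all_order all_algebra.
From mathcomp Require Import all_classical all_reals all_analysis.
From mathcomp Require Import borel_hierarchy.

Set Implicit Arguments.
Unset Strict Implicit.
Unset Printing Implicit Defensive.

Import Order.TTheory GRing.Theory Num.Theory.
Import numFieldNormedType.Exports.

Local Open Scope classical_set_scope.
Local Open Scope ring_scope.

Definition tychonoff_space (T : topologicalType) : Prop :=
  hausdorff_space T /\ completely_regular_space T.

Definition embedding (S T : topologicalType) (f : S -> T) : Prop :=
  injective f /\
  forall A : set S, open A <-> exists2 B : set T, open B & f @^-1` B = A.

Lemma embedding_continuous (S T : topologicalType) (f : S -> T) :
  embedding f -> continuous f.
Proof. by move=> [_ fE]; apply/continuousP => B oB; apply/fE; exists B. Qed.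

Section GeneralTopology.
Implicit Types S T : topologicalType.

Lemma hausdorff_set_type T (A : set T) :
  hausdorff_space T -> hausdorff_space (A : topologicalType).
Proof.
rewrite !open_hausdorff => hT x y xy.
have /hT[[U V] /= [xU yV] [oU oV UV0]] : set_val x != set_val y.
  by apply: contra xy => /eqP /val_inj ->.
exists (set_val @^-1` U, set_val @^-1` V) => /=.
  by rewrite !inE; split; apply: set_mem.
split; [by exists U|by exists V|].
by rewrite -preimage_setI (eqP UV0) preimage_set0.
Qed.

Lemma compact_set_type T (A : set T) :
  compact A -> compact [set: A].
Proof.
move=> cA F PF _.
have PG : ProperFilter (set_val @ F) by exact: fmap_proper_filter.
have [|p [Ap clp]] := cA (set_val @ F) PG.
  by apply: (@filterE _ F) => x; exact: set_valP.
exists (SigSub (mem_set Ap)); split => // U V FU [_ [[W oW <-] Wp WV]].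
have FU' : (set_val @ F) (set_val @` U).
  by apply: (@filterS _ F _ U) => // z Uz; exists z.
have [_ [[z Uz <-] Wz]] := clp (set_val @` U) W FU' (open_nbhs_nbhs (conj oW Wp)).
by exists z; split => //; exact: WV.
Qed.

Lemma continuous_set_type S T (A : set T) (f : S -> A) :
  continuous (fun x => set_val (f x)) -> continuous f.
Proof.
move=> /continuousP cf; apply/continuousP => _ [V oV <-]; exact: (cf _ oV).
Qed.

Lemma continuous_prod_topology S (I : Type) (T_ : I -> topologicalType)
    (f : S -> prod_topology T_) :
  (forall i, continuous (fun x => f x i)) -> continuous f.
Proof.
move=> cf x; apply/cvg_sup => i.
move=> U [_ [[V oV <-] Vx VU]].
have : nbhs x ((fun x => f x i) @^-1` V).
  by apply: cf; exact: open_nbhs_nbhs.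
by apply: filterS => y Vy; exact: VU.
Qed.

Lemma continuous_eq_dense S T (D : set S) (f g : S -> T) :
  hausdorff_space T -> dense D -> continuous f -> continuous g ->
  {in D, f =1 g} -> f = g.
Proof.
rewrite open_hausdorff => hT dD /continuousP cf /continuousP cg fg.
apply/funext => x; apply/eqP; apply: contrapT => /negP.
move=> /hT[[U V] /= [/set_mem Ux /set_mem Vx] [oU oV /eqP UV0]].
have [||z [[/= Uz Vz] Dz]] := dD (f @^-1` U `&` g @^-1` V).
- by exists x.
- by apply: openI; [exact: cf|exact: cg].
have : (U `&` V) (f z) by split=> //; rewrite fg ?inE.
by rewrite UV0.
Qed.

End GeneralTopology.

Section StoneCech.
Variable R : realType.
Implicit Types S T : topologicalType.

Definition unit_interval : topologicalType := (`[0, 1]%classic : set R).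

Lemma unit_interval_compact : compact [set: unit_interval].
Proof. by apply: compact_set_type; exact: segment_compact. Qed.

Lemma unit_interval_hausdorff : hausdorff_space unit_interval.
Proof. by apply: hausdorff_set_type; exact: Rhausdorff. Qed.

Definition unit_cube T : topologicalType :=
  prod_topology (fun _ : continuousType T unit_interval => unit_interval).

Definition cube_eval T (x : T) : unit_cube T := fun f => f x.

(* The closure of the diagonal image of T in the cube [0, 1]^C(T, [0, 1]). For
   Tychonoff T, stone_cech_in is an embedding (stone_cech_in_embedding). *)
Definition stone_cech T : topologicalType := closure (range (@cube_eval T)).

Definition stone_cech_in T (x : T) : stone_cech T :=
  SigSub (mem_set (subset_closure (imageT (@cube_eval T) x))).

Lemma unit_cube_compact T : compact [set: unit_cube T].
Proof.
have -> : [set: unit_cube T] = [set f | forall i, [set: unit_interval] (f i)].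
  by apply/seteqP; split.
exact: (tychonoff (fun=> unit_interval_compact)).
Qed.

Lemma stone_cech_compact T : compact [set: stone_cech T].
Proof.
apply: compact_set_type; apply: (subclosed_compact _ (@unit_cube_compact T)).
- exact: closed_closure.
- by [].
Qed.

Lemma stone_cech_hausdorff T : hausdorff_space (stone_cech T).
Proof.
apply: hausdorff_set_type; apply: hausdorff_product => f.
exact: unit_interval_hausdorff.
Qed.

Lemma stone_cech_in_continuous T : continuous (@stone_cech_in T).
Proof.
apply: continuous_set_type; apply: continuous_prod_topology => f.
exact: (@cts_fun _ _ f).
Qed.

Lemma stone_cech_in_dense T : dense (range (@stone_cech_in T)).
Proof.
move=> O [z Oz] [V oV VO]; move: Oz; rewrite -VO /= => Vz.
have [_ [[x _ <-] Vx]] := set_valP z V (open_nbhs_nbhs (conj oV Vz)).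
by exists (stone_cech_in x); split => //; exists x.
Qed.

Lemma stone_cech_in_embedding T :
  tychonoff_space T -> embedding (@stone_cech_in T).
Proof.
move=> [hT crT].
have sep (x : T) (C : set T) : closed C -> ~ C x ->
    exists f : continuousType T unit_interval,
      set_val (f x) = 0 /\ forall y, C y -> set_val (f y) = 1.
  move=> cC nCx.
  have /(@uniform_separatorP _ R)[f [cf f01 fx fC]] := crT x C cC nCx.
  have f01' y : f y \in `[0, 1]%classic by apply/mem_set/f01; exists y.
  pose g (y : T) : unit_interval := SigSub (f01' y).
  have cg : continuous g by apply: continuous_set_type.
  exists (mkcts cg); split; first by apply: fx; exists x.
  by move=> y Cy; apply: fC; exists y.
split.
  move=> x y xy; apply: contrapT => nxy.
  have [|f [fx fy]] := sep x [set y] _ nxy.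
    exact/accessible_closed_set1/hausdorff_accessible.
  have : f x = f y by have := congr1 (fun z => set_val z f) xy.
  by move=> /(congr1 set_val); rewrite fx fy// => /esym/eqP; rewrite oner_eq0.
move=> A; split; last first.
  move=> [B oB <-].
  by have /continuousP := @stone_cech_in_continuous T; apply.
move=> oA.
pose P := [set B : set (stone_cech T) | open B /\ @stone_cech_in T @^-1` B `<=` A].
exists (\bigcup_(B in P) B); first by apply: bigcup_open => B [].
apply/seteqP; split; first by move=> x [B [_ BA] Bx]; exact: BA.
move=> x Ax.
have [||f [fx fA]] := sep x (~` A); [exact: open_closedC|exact|].
pose B := [set z : stone_cech T | set_val (set_val z f) < 1].
exists B; last by rewrite /B /= [X in X < _]fx.
split.
  have cz : continuous (fun z : stone_cech T => set_val (set_val z f) : R).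
    move=> z; apply: continuous_comp; last exact: initial_continuous.
    apply: (@continuous_comp _ _ _ set_val (fun h : unit_cube T => h f)).
      exact: initial_continuous.
    exact: (@proj_continuous _ (fun=> unit_interval) f).
  have /continuousP/(_ [set r | r < 1]) := cz; apply; exact: open_lt.
move=> y; rewrite /B /= => fy; apply: contrapT => nAy.
by move: fy; rewrite [X in X < _](fA y nAy) ltxx.
Qed.

Lemma stone_cech_extension S T (f : S -> T) : continuous f ->
  exists F : stone_cech S -> stone_cech T, continuous F /\
    forall x, F (stone_cech_in x) = stone_cech_in (f x).
Proof.
move=> cf.
pose G (z : unit_cube S) : unit_cube T := fun g => z (g \o mkcts cf).
have cG : continuous G.
  apply: continuous_prod_topology => g.
  pose gf : continuousType S unit_interval := g \o mkcts cf.
  exact: (@proj_continuous _ (fun=> unit_interval) gf).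
have Gcl z : closure (range (@cube_eval S)) z ->
             closure (range (@cube_eval T)) (G z).
  move=> clz V /cG /clz[_ [[x _ <-] Vx]].
  by exists (cube_eval (f x)); split => //; exists (f x).
exists (fun z => SigSub (mem_set (Gcl _ (set_valP z)))); split.
  apply: continuous_set_type => z.
  by apply: (@continuous_comp _ _ _ set_val G); [exact: initial_continuous|exact: cG].
by move=> x; exact: val_inj.
Qed.

Lemma stone_cech_extension_unique S T (F G : stone_cech S -> T) :
  hausdorff_space T -> continuous F -> continuous G ->
  (forall x, F (stone_cech_in x) = G (stone_cech_in x)) -> F = G.
Proof.
move=> hT cF cG FG.
apply: (continuous_eq_dense hT (@stone_cech_in_dense S) cF cG) => _ /set_mem[x _ <-].
exact: FG.
Qed.

Lemma stone_cech_universal S T (f : S -> T) :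
  compact [set: T] -> hausdorff_space T -> continuous f ->
  exists F : stone_cech S -> T, continuous F /\
    forall x, F (stone_cech_in x) = f x.
Proof.
move=> cT hT /stone_cech_extension[F [cF Ff]].
have tT : tychonoff_space T.
  split=> //; apply: (@normal_completely_regular R).
    exact: compact_normal.
  exact: hausdorff_accessible.
have [inj opn] := stone_cech_in_embedding tT.
have surj (z : stone_cech T) : exists x, stone_cech_in x = z.
  have cl : closed (range (@stone_cech_in T)).
    apply: compact_closed; first exact: stone_cech_hausdorff.
    apply: continuous_compact => //; apply: continuous_subspaceT.
    exact: stone_cech_in_continuous.
  apply: contrapT => nz.
  have nzr : (~` range (@stone_cech_in T)) z.
    by move=> [x _ xz]; apply: nz; exists x.
  by have [w [nw /nw]] := stone_cech_in_dense (ex_intro _ z nzr) (closed_openC cl).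
pose g z := sval (cid (surj z)).
have gK z : stone_cech_in (g z) = z by rewrite /g; case: cid.
exists (g \o F); split; last by move=> x; apply: inj; rewrite /= gK Ff.
apply/continuousP => A /opn[B oB <-].
suff -> : (g \o F) @^-1` (@stone_cech_in T @^-1` B) = F @^-1` B.
  by move/continuousP : cF; apply.
by apply/seteqP; split => z /=; rewrite gK.
Qed.

Definition stone_cech_remainder T : set (stone_cech T) :=
  ~` range (@stone_cech_in T).

Definition zero_sets T : set (set T) :=
  [set f @^-1` [set 0] | f in [set f : T -> R | continuous f]].

Definition cech_complete T : Prop :=
  tychonoff_space T /\ Gdelta (range (@stone_cech_in T)).

End StoneCech.
Arguments zero_sets : clear implicits.
Arguments cech_complete : clear implicits.
Arguments stone_cech_remainder : clear implicits.
Arguments stone_cech_in R {T}.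

Record one_point_extension (X : topologicalType) := OnePointExtension {
  ext_space :> topologicalType ;
  ext_in : X -> ext_space ;
  ext_pt : ext_space ;
  ext_tychonoff : tychonoff_space ext_space ;
  ext_embedding : embedding ext_in ;
  ext_dense : dense (range ext_in) ;
  ext_remainder : ~` range ext_in = [set ext_pt] }.

(* A point of T(X) is a class for this relation. An extension is handled
   through a representative: mu and Cech-completeness depend only on the class,
   by mu_ext_equiv and cech_complete_ext_equiv. *)
Definition ext_equiv (X : topologicalType) (Y Z : one_point_extension X) : Prop :=
  exists (h : Y -> Z) (k : Z -> Y), [/\ continuous h, continuous k,
    cancel h k, cancel k h & forall x, h (ext_in Y x) = ext_in Z x].

Section Mu.
Variables (R : realType) (X : topologicalType).
Implicit Types Y Z : one_point_extension X.

(* The map F_Y; it is unique by stone_cech_extension_unique. *)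
Definition ext_map Y : stone_cech R X -> stone_cech R Y :=
  sval (cid (stone_cech_extension R (embedding_continuous (ext_embedding Y)))).

Lemma ext_map_continuous Y : continuous (@ext_map Y).
Proof. by rewrite /ext_map; case: cid => F []. Qed.

Lemma ext_map_in Y (x : X) :
  @ext_map Y (stone_cech_in R x) = stone_cech_in R (ext_in Y x).
Proof. by rewrite /ext_map; case: cid => F []. Qed.

Definition mu Y : set (stone_cech R X) :=
  @ext_map Y @^-1` [set stone_cech_in R (ext_pt Y)].

Lemma mu_remainder Y : mu Y `<=` stone_cech_remainder R X.
Proof.
move=> z Yz [x _ xz]; move: Yz; rewrite /mu /= -xz ext_map_in.
have [inj _] := stone_cech_in_embedding R (ext_tychonoff Y).
move/inj => xp; have : (~` range (ext_in Y)) (ext_pt Y).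
  by rewrite ext_remainder.
by apply; exists x.
Qed.

Lemma ext_equiv_pt Y Z (h : Y -> Z) (k : Z -> Y) : cancel h k -> cancel k h ->
  (forall x, h (ext_in Y x) = ext_in Z x) -> h (ext_pt Y) = ext_pt Z.
Proof.
move=> hk kh hx.
have : (~` range (ext_in Z)) (h (ext_pt Y)); last by rewrite ext_remainder.
move=> [x _]; rewrite -hx => /(can_inj hk) xp.
have : (~` range (ext_in Y)) (ext_pt Y) by rewrite ext_remainder.
by apply; exists x.
Qed.

Lemma mu_ext_equiv Y Z : ext_equiv Y Z -> mu Y = mu Z.
Proof.
suff sub Y1 Z1 : ext_equiv Y1 Z1 -> mu Y1 `<=` mu Z1.
  move=> YZ; apply/seteqP; split; apply: sub => //.
  move: YZ => [h [k [ch ck hk kh hx]]].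
  by exists k, h; split => // x; rewrite -hx hk.
move=> [h [k [ch ck hk kh hx]]] z; rewrite /mu /= => Yz.
have [F [cF Fh]] := stone_cech_extension R ch.
have <- : F \o @ext_map Y1 = @ext_map Z1.
  apply: stone_cech_extension_unique.
  - exact: stone_cech_hausdorff.
  - move=> w; apply: continuous_comp; [exact: ext_map_continuous|exact: cF].
  - exact: ext_map_continuous.
  - by move=> x /=; rewrite !ext_map_in Fh hx.
by rewrite /= Yz Fh (ext_equiv_pt hk kh hx).
Qed.

Lemma cech_complete_ext_equiv Y Z :
  ext_equiv Y Z -> cech_complete R Y -> cech_complete R Z.
Proof.
move=> [h [k [ch ck hk kh hx]]] [_ [U oU UE]]; split.
  exact: ext_tychonoff.
have [F [cF Fh]] := stone_cech_extension R ch.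
have [G [cG Gk]] := stone_cech_extension R ck.
have FG : F \o G = id.
  apply: stone_cech_extension_unique.
  - exact: stone_cech_hausdorff.
  - by move=> w; apply: continuous_comp; [exact: cG|exact: cF].
  - by move=> w; exact: cvg_id.
  - by move=> x /=; rewrite Gk Fh kh.
exists (fun n => G @^-1` U n).
  by move=> n; move/continuousP : cG; apply.
rewrite -preimage_bigcap -UE; apply/seteqP; split.
  by move=> _ [x _ <-]; exists (k x).
move=> w [y _ yw]; exists (h y) => //.
by rewrite -Fh yw; have := congr1 (@^~ w) FG.
Qed.

End Mu.
Arguments mu R {X} Y.

Definition cech_complete_extension (R : realType) (X : topologicalType)
  (Y : one_point_extension X) : Prop := cech_complete R Y.

(* The image of a class of extensions under mu. It is not an instance of the
   library's [set _ | _ in _], because one_point_extension X, which quantifies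
   over all spaces, lives in a universe above that of set. *)
Definition mu_image (R : realType) (X : topologicalType)
    (P : one_point_extension X -> Prop) : set (set (stone_cech R X)) :=
  [set A | exists2 Y, P Y & mu R Y = A].
Arguments cech_complete_extension : clear implicits.
Arguments mu_image : clear implicits.

(* Main.v *)
Require Import Defs.
From mathcomp Require Import all_boot all_order all_algebra.
From mathcomp Require Import all_classical all_reals all_analysis.
From mathcomp Require Import borel_hierarchy lra.

(** Write B for the Stone-Cech compactification of X and X* for its remainder.
    A locally compact X is open in B, so X* is compact; hence it is normal, and
    its zero-sets are exactly its closed G-delta subsets.

    The key fact (embedding_extension_fiber) is that the extension to the
    Stone-Cech compactification of an embedding into a Hausdorff space never
    sends a remainder point onto the image of the embedding.

    Let Y = X u {p} be Cech-complete, with F : B -> beta Y. By the key fact,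
    F^-1(Y) = X u mu(Y), so X u mu(Y) is a G-delta in B, and its trace mu(Y) on
    X* is a closed G-delta of X*, hence a zero-set (mu_zero_set). It is nonempty
    because F is onto.

    Conversely, let Z be a nonempty zero-set of a function f on X*. It is
    compact, and collapsing it to a point p gives a compact Hausdorff quotient
    q : B -> K into which X still embeds. Put Y = q(X) u {p}; p is in the closure
    of q(X) because Z is nonempty. The complement of Y in K is the countable
    union of the compact images of the sets where |f| >= 1/(n+1), so Y is a
    G-delta in K. The key fact, applied to the extension beta Y -> K of the
    inclusion, turns this into a G-delta in beta Y, and also shows that mu(Y),
    the fibre of F over p, is the fibre of q over p, which is Z (zero_set_mu). *)

Set Implicit Arguments.
Unset Strict Implicit.
Unset Printing Implicit Defensive.

Import Order.TTheory GRing.Theory Num.Theory.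
Import numFieldNormedType.Exports.

Local Open Scope classical_set_scope.
Local Open Scope ring_scope.

(** * Embeddings, subspaces and G-delta sets *)

Lemma Gdelta_preimage (S T : topologicalType) (f : S -> T) (A : set T) :
  continuous f -> Gdelta A -> Gdelta (f @^-1` A).
Proof.
move=> /continuousP cf [U oU ->]; exists (fun n => f @^-1` U n).
  by move=> n; apply: cf.
by rewrite preimage_bigcap.
Qed.

Lemma embedding_comp (S T U : topologicalType) (g : T -> U) (f : S -> T) :
  embedding g -> embedding f -> embedding (g \o f).
Proof.
move=> [gI gE] [fI fE]; split; first exact: inj_comp.
move=> A; split=> [/fE[B /gE[C oC <-] <-]|[C oC <-]]; first by exists C.
by apply/fE; exists (g @^-1` C) => //; apply/gE; exists C.
Qed.

Lemma embedding_set_val (T : topologicalType) (A : set T) :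
  embedding (set_val : A -> T).
Proof. by split; [exact: val_inj|move=> B; split; case=> C oC CB; exists C]. Qed.

Lemma embedding_compact_preimage (S T : topologicalType) (e : S -> T)
    (C : set T) :
  embedding e -> C `<=` range e -> compact C -> compact (e @^-1` C).
Proof.
move=> [_ eE] Ce cC F PF FC.
have [p [Cp clp]] := cC (e @ F) (fmap_proper_filter _ PF) FC.
have [s _ sp] := Ce _ Cp; exists s; split; first by rewrite /= sp.
move=> U V FU; rewrite nbhsE => -[V' [/eE[W oW <-] Ws] WV].
have [||_ [[z Uz <-] Wz]] := clp (e @` U) W.
- by apply: (@filterS _ F _ U) => // z Uz; exists z.
- by apply: open_nbhs_nbhs; rewrite -sp.
- by exists z; split => //; exact: WV.
Qed.

Lemma completely_regular_set_type (R : realType) (T : topologicalType)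
    (A : set T) :
  completely_regular_space T -> completely_regular_space (A : topologicalType).
Proof.
move=> crT x C /closed_openC[U oU UC] nCx.
have Ux : U (set_val x) by have : (~` C) x by []; rewrite -UC.
have /(@uniform_separatorP _ R)[f [cf f01 f0 f1]] :=
  crT (set_val x) (~` U) (open_closedC oU) (fun nU => nU Ux).
apply/(@uniform_separatorP _ R); exists (f \o set_val); split.
- by move=> y; apply: continuous_comp; [exact: initial_continuous|exact: cf].
- by move=> _ [y _ <-]; apply: f01; exists (set_val y).
- by move=> _ [_ -> <-]; apply: f0; exists (set_val x).
- move=> _ [y Cy <-]; apply: f1; exists (set_val y) => // Uy.
  by have : (~` C) y; [rewrite -UC|apply].
Qed.

Lemma compact_tychonoff (R : realType) (T : topologicalType) :
  compact [set: T] -> hausdorff_space T -> tychonoff_space T.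
Proof.
move=> cT hT; split=> //; apply: (@normal_completely_regular R).
  exact: compact_normal.
exact: hausdorff_accessible.
Qed.

(** Urysohn functions [f n] vanishing on [A] and equal to 1 off the [n]-th open
    set are glued by the supremum of the [f n / n.+1]. The weights make the
    supremum continuous: near a given point, all but finitely many terms are
    uniformly small. *)
Lemma closed_Gdelta_zero_set (R : realType) (T : topologicalType)
    (A : set T) : normal_space T -> closed A -> Gdelta A -> zero_sets R T A.
Proof.
move=> /(@normal_separatorP R) nT clA [V oV AE].
have sep n : exists f : T -> R, [/\ continuous f, forall x, 0 <= f x <= 1,
    forall x, A x -> f x = 0 & forall x, ~ V n x -> f x = 1].
  have AV0 : A `&` ~` V n = set0.
    by apply/disjoints_subset; rewrite setCK AE; exact: bigcap_inf.
  have /(@uniform_separatorP _ R)[f [cf f01 f0 f1]] :=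
    nT _ _ clA (open_closedC (oV n)) AV0.
  exists f; split => // x.
  - have /= : `[0, 1]%classic (f x) by apply: f01; exists x.
    by rewrite in_itv.
  - by move=> Ax; apply: f0; exists x.
  - by move=> Vx; apply: f1; exists x.
pose f n := sval (cid (sep n)).
have fP n : [/\ continuous (f n), forall x, 0 <= f n x <= 1,
    forall x, A x -> f n x = 0 & forall x, ~ V n x -> f n x = 1].
  by rewrite /f; case: cid.
pose g n x := f n x / n.+1%:R.
pose h x := sup (range (g ^~ x)).
have g0 n x : 0 <= g n x.
  by have [_ /(_ x)/andP[? _] _ _] := fP n; rewrite divr_ge0.
have gn n x : g n x <= n.+1%:R^-1.
  by have [_ /(_ x)/andP[_ ?] _ _] := fP n; rewrite ler_piMl.
have gh n x : g n x <= h x.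
  apply: ub_le_sup; last by exists n.
  exists 1 => _ [m _ <-]; apply: le_trans (gn m x) _.
  by rewrite invf_le1// ler1n.
have hg x c : (forall n, g n x <= c) -> h x <= c.
  by move=> gc; apply: ge_sup; [exists (g 0%N x); exists 0%N|move=> _ [n _ <-]].
exists h; last first.
  apply/seteqP; split => x /=.
    move=> hx0; rewrite AE => n _; apply: contrapT => nVx.
    have [_ _ _ /(_ x nVx) fx1] := fP n.
    by have := gh n x; rewrite /g fx1 hx0 leNgt mul1r invr_gt0 ltr0n.
  move=> Ax; apply/eqP; rewrite eq_le (le_trans (g0 0%N x) (gh 0%N x)) andbT.
  by apply: hg => n; have [_ _ /(_ x Ax) fx0 _] := fP n; rewrite /g fx0 mul0r.
move=> x; apply/cvgrPdist_le => e e0.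
have [N Ne] : exists N, N.+1%:R^-1 <= e.
  have [N _ /(_ N (leqnn N)) /ltW] := near_infty_natSinv_lt (PosNum e0).
  by exists N.
(* Terms of index at least N lie in [0, e], so only the first N matter. *)
have nearg : \forall y \near x, forall n, (n < N)%N -> `|g n x - g n y| <= e.
  elim: N {Ne} => [|N IHN]; first by apply: nearW.
  have : \forall y \near x, `|g N x - g N y| <= e.
    have gc : {for x, continuous (g N)}.
      by have [/(_ x) cf _ _ _] := fP N; apply: cvgMl.
    by move/cvgrPdist_le : gc; apply.
  apply: filterS2 IHN => y IHN gN n; rewrite ltnS leq_eqVlt => /predU1P[->//|].
  exact: IHN.
apply: filterS nearg => y nearg.
have gxy n : `|g n x - g n y| <= e.
  have [/nearg//|Nn] := ltnP n N.
  have le_e z : g n z <= e.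
    apply: le_trans (gn n z) (le_trans _ Ne).
    by rewrite lef_pV2 ?posrE// ler_nat.
  have := (g0 n x, g0 n y, le_e x, le_e y) => -[[[gx0 gy0] gxe] gye].
  by rewrite ler_norml; apply/andP; split; lra.
have hle u v : (forall n, `|g n u - g n v| <= e) -> h u <= h v + e.
  move=> guv; apply: hg => n; have := guv n; rewrite ler_norml => /andP[_ guve].
  by have := gh n v; lra.
have hxy := hle _ _ gxy.
have hyx : h y <= h x + e by apply: hle => n; rewrite distrC.
by rewrite ler_norml; apply/andP; split; lra.
Qed.

(** * Extensions of embeddings to the Stone-Cech compactification *)

Section Remainder.
Variable R : realType.
Implicit Types S T K X : topologicalType.

(** If [z] differed from [s], disjoint neighbourhoods [U] of [z] and [V] of [s]
    would exist. As [j] is an embedding, [V] is on [S] the trace of an open set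
    [W] around [j s]; by density [U `&` G @^-1` W] meets [S], at a point which is
    in both [U] and [V]. *)
Lemma embedding_extension_fiber S K (j : S -> K) (G : stone_cech R S -> K)
    (z : stone_cech R S) (s : S) :
  embedding j -> continuous G -> (forall x, G (stone_cech_in R x) = j x) ->
  G z = j s -> z = stone_cech_in R s.
Proof.
move=> [_ jE] /continuousP cG Gj Gz; apply/eqP/negPn/negP.
have := @stone_cech_hausdorff R S; rewrite open_hausdorff => /[apply].
move=> -[[U V] /= [/set_mem Uz /set_mem Vs] [oU oV /eqP UV0]].
have [W oW WV] : exists2 W : set K, open W &
    j @^-1` W = stone_cech_in R @^-1` V.
  apply/jE; have /continuousP := @stone_cech_in_continuous R S; exact.
have Wj : W (j s) by rewrite -[W _]/((j @^-1` W) s) WV.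
have [||w [[/= Uw Ww] [x _ xE]]] := @stone_cech_in_dense R S (U `&` G @^-1` W).
- by exists z; split => //=; rewrite Gz.
- by apply: openI => //; exact: cG.
have Vx : (stone_cech_in R @^-1` V) x by rewrite -WV /= -Gj xE.
by suff : (U `&` V) (stone_cech_in R x); [rewrite UV0|split => //; rewrite xE].
Qed.

Lemma embedding_extension_preimage S K (j : S -> K) (G : stone_cech R S -> K) :
  embedding j -> continuous G -> (forall x, G (stone_cech_in R x) = j x) ->
  G @^-1` range j = range (stone_cech_in R).
Proof.
move=> ej cG Gj; apply/seteqP; split=> [z [s _ /esym Gz]|_ [s _ <-]].
  by exists s => //; apply/esym/(embedding_extension_fiber ej cG Gj).
by exists s.
Qed.

(** Cech-completeness can be tested in any Hausdorff compactification, since the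
    Stone-Cech compactification maps to it without sending remainder points into
    the space. *)
Lemma cech_complete_compactification S K (j : S -> K) :
  tychonoff_space S -> compact [set: K] -> hausdorff_space K -> embedding j ->
  Gdelta (range j) -> cech_complete R S.
Proof.
move=> tS cK hK ej Gj; split => //.
have [G [cG Gin]] := stone_cech_universal R cK hK (embedding_continuous ej).
by rewrite -(embedding_extension_preimage ej cG Gin); apply: Gdelta_preimage.
Qed.

(** A compact neighbourhood [C] of [x] in [X] is closed in the compactification.
    An open set [U] with trace [C°] is contained, by density, in the closure of
    that trace, hence in the image of [C]. *)
Lemma open_range_stone_cech_in X :
  locally_compact [set: X] -> hausdorff_space X ->
  open (range (@stone_cech_in R X)).
Proof.
move=> lcX hX.
have tX : tychonoff_space X.
  by split=> //; exact: (@locally_compact_completely_regular X R).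
have [_ inE] := stone_cech_in_embedding R tX.
rewrite openE => _ [x _ <-].
have [C] := lcX x I; rewrite withinET => Cx [cC _].
have [U oU UC] : exists2 U, open U & @stone_cech_in R X @^-1` U = C°.
  by apply/inE; exact: open_interior.
have clC : closed (stone_cech_in R @` C).
  apply: compact_closed; first exact: stone_cech_hausdorff.
  apply: continuous_compact => //; apply: continuous_subspaceT.
  exact: stone_cech_in_continuous.
have Ux : U (stone_cech_in R x).
  by rewrite -[U _]/((_ @^-1` U) x) UC; exact: nbhs_singleton (nbhs_interior Cx).
apply: (@filterS _ _ _ U); last exact: open_nbhs_nbhs.
move=> z Uz; suff /clC[y _ yz] : closure (stone_cech_in R @` C) z by exists y.
move=> W Wz; have [||w [[Ww Uw] [y _ yw]]] := @stone_cech_in_dense R X (W° `&` U).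
- by exists z; split => //; exact: nbhs_singleton (nbhs_interior Wz).
- by apply: openI => //; exact: open_interior.
exists w; split; last exact: interior_subset.
exists y => //; apply: interior_subset; rewrite -UC /=.
by rewrite yw.
Qed.

Lemma stone_cech_remainder_compact X :
  locally_compact [set: X] -> hausdorff_space X ->
  compact (stone_cech_remainder R X).
Proof.
move=> lcX hX; apply: (subclosed_compact _ (@stone_cech_compact R X)) => //.
by apply: open_closedC; exact: open_range_stone_cech_in.
Qed.

Lemma embedding_ext_in_beta X (Y : one_point_extension X) :
  embedding (stone_cech_in R \o ext_in Y).
Proof.
apply: embedding_comp; last exact: ext_embedding.
exact/stone_cech_in_embedding/ext_tychonoff.
Qed.

Lemma range_ext X (Y : one_point_extension X) :
  [set: Y] = range (ext_in Y) `|` [set ext_pt Y].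
Proof. by rewrite -ext_remainder setUv. Qed.

(** The image of the extension map is compact, hence closed, and contains the
    dense set [X]. *)
Lemma mu_neq0 X (Y : one_point_extension X) : mu R Y !=set0.
Proof.
set F := @ext_map R X Y.
have clF : closed (range F).
  apply: compact_closed; first exact: stone_cech_hausdorff.
  apply: continuous_compact; last exact: stone_cech_compact.
  by apply: continuous_subspaceT; exact: ext_map_continuous.
have [z _ Fz] : range F (stone_cech_in R (ext_pt Y)); last by exists z.
apply: clF => V; rewrite nbhsE => -[W [oW Wp] WV].
have [||_ [/[swap] -[x _ <-] Wx]] := @ext_dense X Y (stone_cech_in R @^-1` W).
- by exists (ext_pt Y).
- by have /continuousP := @stone_cech_in_continuous R Y; exact.
exists (stone_cech_in R (ext_in Y x)); split; last exact: WV.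
by exists (stone_cech_in R x) => //; rewrite /F ext_map_in.
Qed.

(** The preimage of [p] is [mu R Y] by definition, and over [X] there is nothing
    but [X] itself, because [X] embeds into the compactification of [Y]. *)
Lemma ext_map_preimage X (Y : one_point_extension X) :
  @ext_map R X Y @^-1` range (stone_cech_in R) =
  range (stone_cech_in R) `|` mu R Y.
Proof.
rewrite -(embedding_extension_preimage (embedding_ext_in_beta Y)
  (@ext_map_continuous R X Y) (@ext_map_in R X Y)) /mu -preimage_setU.
congr (_ @^-1` _).
by rewrite range_ext image_setU image_set1 image_comp.
Qed.

Lemma mu_zero_set X (Y : one_point_extension X) :
  locally_compact [set: X] -> hausdorff_space X -> cech_complete R Y ->
  zero_sets R (stone_cech_remainder R X) (set_val @^-1` mu R Y).
Proof.
move=> lcX hX [_ GY]; apply: closed_Gdelta_zero_set.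
- apply: compact_normal.
    exact/hausdorff_set_type/stone_cech_hausdorff.
  exact/compact_set_type/stone_cech_remainder_compact.
- apply: preimage_closed => [z _|]; first exact: initial_continuous.
  apply: preimage_closed => [z _|]; first exact: ext_map_continuous.
  exact/accessible_closed_set1/hausdorff_accessible/stone_cech_hausdorff.
- have -> : set_val @^-1` mu R Y =
      (set_val : stone_cech_remainder R X -> _) @^-1`
        (@ext_map R X Y @^-1` range (stone_cech_in R)).
    rewrite ext_map_preimage; apply/seteqP; split=> z /=; first by right.
    by case=> // zX; have := set_valP z.
  apply: Gdelta_preimage; first exact: initial_continuous.
  by apply: Gdelta_preimage => //; exact: ext_map_continuous.
Qed.

End Remainder.

(** * Collapsing a closed subset of a compact Hausdorff space *)

Lemma open_locally_compact (T : topologicalType) (O : set T) :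
  compact [set: T] -> hausdorff_space T -> open O ->
  locally_compact [set: O].
Proof.
move=> cT hT oO x _.
have Ox : nbhs (set_val x) O by apply: open_nbhs_nbhs; split; [|exact: set_valP].
have [C Cx CO] := compact_regular hT cT filterT Ox.
rewrite withinET; exists (set_val @^-1` closure C).
  by apply: initial_continuous; apply: filterS Cx; exact: subset_closure.
split; last first.
  apply: preimage_closed => [z _|]; first exact: initial_continuous.
  exact: closed_closure.
apply: embedding_compact_preimage; first exact: embedding_set_val.
  by move=> z /CO Oz; exists (SigSub (mem_set Oz)).
exact: (subclosed_compact (@closed_closure _ C) cT).
Qed.

Section Pinch.
Variables (T : topologicalType) (Z : set T).
Hypotheses (cT : compact [set: T]) (hT : hausdorff_space T) (clZ : closed Z).

(** For nonempty [Z], this is the quotient of [T] that collapses [Z] to the point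
    [None]. Taking the one-point compactification of the complement of [Z] gives
    compactness and separation without a study of quotient topologies. *)
Definition pinched : topologicalType :=
  one_point_compactification (~` Z : set T).

Definition pinch (z : T) : pinched := insub z.

Lemma pinch_None z : (pinch z = None) <-> Z z.
Proof.
rewrite /pinch; case: insubP => [u /set_mem nZz _|]; first by split.
by rewrite notin_setE => /contrapT.
Qed.

Lemma pinch_Some z (u : ~` Z) : pinch z = Some u <-> set_val u = z.
Proof.
split=> [|<-]; last exact: valK.
by rewrite /pinch; case: insubP => // v _ <- [->].
Qed.

Lemma pinch_out z : ~ Z z -> exists2 u : ~` Z, set_val u = z & pinch z = Some u.
Proof.
move=> nZ; exists (SigSub (mem_set (nZ : (~` Z) z))) => //.
exact/pinch_Some.
Qed.

Lemma pinched_compact : compact [set: pinched].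
Proof. exact: one_point_compactification_compact. Qed.

Lemma pinched_hausdorff : hausdorff_space pinched.
Proof.
apply: one_point_compactification_hausdorff; last exact: hausdorff_set_type.
by apply: open_locally_compact => //; exact: closed_openC.
Qed.

Lemma pinch_continuous : continuous pinch.
Proof.
move=> z U; have [Zz|nZz] := pselect (Z z).
  have -> : pinch z = None by apply/pinch_None.
  move=> [C [cC _] CU].
  have clC : closed (set_val @` C).
    apply: compact_closed => //; apply: continuous_compact => //.
    by apply: continuous_subspaceT; exact: initial_continuous.
  have : nbhs z (~` (set_val @` C)).
    apply: open_nbhs_nbhs; split; first exact: closed_openC.
    by move=> [u _ uz]; have : (~` Z) (set_val u) := set_valP u; rewrite uz.
  apply: filterS => w nCw; apply: CU.
  rewrite /pinch; case: insubP => [u _ uw|_]; last by right.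
  by left; exists u => // Cu; apply: nCw; exists u.
have [u uz ->] := pinch_out nZz.
move=> -[_ [[V oV <-] /= Vu VU]].
have : nbhs z (V `&` ~` Z).
  apply: open_nbhs_nbhs; rewrite -uz; split.
    by apply: openI => //; exact: closed_openC.
  by split => //; exact: set_valP.
apply: filterS => w [Vw nZw]; rewrite /=.
have [v vw ->] := pinch_out nZw; apply: VU.
by rewrite /= vw.
Qed.

(** Off [Z] the collapsing map is a homeomorphism onto an open set. *)
Lemma pinch_embedding (S : topologicalType) (e : S -> T) :
  embedding e -> range e `<=` ~` Z -> embedding (pinch \o e).
Proof.
move=> [eI eE] eZ.
have pe s : exists2 u : ~` Z, set_val u = e s & pinch (e s) = Some u.
  by apply: pinch_out; apply: eZ; exists s.
split.
  move=> x y /=; have [u ux ->] := pe x; have [v vy ->] := pe y.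
  by move=> -[uv]; apply: eI; rewrite -ux -vy uv.
move=> A; split=> [/eE[B oB <-]|[B oB <-]]; last first.
  apply/eE; exists (pinch @^-1` B) => //.
  by have /continuousP := pinch_continuous; exact.
exists (Some @` (set_val @^-1` B)).
  by apply: one_point_compactification_open_some; exists B.
apply/seteqP; split=> s /=; have [u us ->] := pe s.
  by move=> [v /[swap] -[->]]; rewrite us.
by exists u => //=; rewrite us.
Qed.

(** Every point but [None] comes from exactly one point off [Z], so the complement
    of this set is the union of the images of the compact sets [C n]; those images
    are closed. *)
Lemma pinch_Gdelta (A : set T) (C : nat -> set T) :
  (forall n, compact (C n)) -> ~` (A `|` Z) = \bigcup_n C n ->
  Gdelta (pinch @` A `|` [set None]).
Proof.
move=> cC CE; exists (fun n => ~` (pinch @` C n)).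
  move=> n; apply: closed_openC; apply: compact_closed.
    exact: pinched_hausdorff.
  apply: continuous_compact => //; apply: continuous_subspaceT.
  exact: pinch_continuous.
have CAZ n z : C n z -> ~ (A `|` Z) z.
  by move=> Cz; rewrite -[~ _]/((~` (A `|` Z)) z) CE; exists n.
apply/seteqP; split=> [y yA n _ [c Cc cy]|[u|] uC]; last by right.
- have [nA nZ] : ~ A c /\ ~ Z c by apply/not_orP; exact: CAZ Cc.
  case: yA => [[a Aa ay]|/= yN]; last by apply/nZ/pinch_None; rewrite cy.
  have [v vc pc] := pinch_out nZ.
  by apply: nA; move: ay; rewrite -cy pc => /pinch_Some; rewrite vc => ->.
- left; exists (set_val u); last exact/pinch_Some.
  apply: contrapT => nA; have : (\bigcup_n C n) (set_val u).
    by rewrite -CE => -[//|]; exact: set_valP u.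
  move=> [n _ Cn]; apply: (uC n I); exists (set_val u) => //.
  exact/pinch_Some.
Qed.

End Pinch.

(** * Adjoining a point of a compactification *)

Section AdjoinPoint.
Variables (R : realType) (X K : topologicalType) (j : X -> K) (p : K).
Hypotheses (cK : compact [set: K]) (hK : hausdorff_space K).
Hypotheses (ej : embedding j) (jp : ~ range j p) (clp : closure (range j) p).

Let Y : topologicalType := (range j `|` [set p] : set K).

Let Yin (x : X) : Y := SigSub (mem_set (or_introl (imageT j x))).

Let Ypt : Y := SigSub (mem_set (or_intror (erefl p))).

Let Y_tychonoff : tychonoff_space Y.
Proof.
have [_ crK] := compact_tychonoff R cK hK.
by split; [exact: hausdorff_set_type|exact: (completely_regular_set_type R)].
Qed.

Let Y_embedding : embedding Yin.
Proof.
have [jI jE] := ej; split=> [x y /(congr1 set_val)/jI //|A]; split.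
  by move=> /jE[B oB BA]; exists (set_val @^-1` B) => //; exists B.
by move=> [_ [B oB <-] BA]; apply/jE; exists B.
Qed.

Let Y_dense : dense (range Yin).
Proof.
move=> O [y Oy] [V oV VO]; rewrite -VO in Oy *.
have [_ [[x _ <-] Vx]] : range j `&` V !=set0.
  have [jy|yp] : (range j `|` [set p]) (set_val y) := set_valP y.
    by exists (set_val y); split.
  by apply: clp; rewrite -yp; exact: open_nbhs_nbhs.
by exists (Yin x); split.
Qed.

Let Y_remainder : ~` range Yin = [set Ypt].
Proof.
apply/seteqP; split=> [y ny|_ -> [x _ /(congr1 set_val) xp]]; last first.
  by apply: jp; exists x.
apply: val_inj.
have [[x _ xy]|//] : (range j `|` [set p]) (set_val y) := set_valP y.
by case: ny; exists x => //; exact: val_inj.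
Qed.

Definition adjoin_point : one_point_extension X :=
  OnePointExtension Y_tychonoff Y_embedding Y_dense Y_remainder.

Let range_val : range (set_val : adjoin_point -> K) = range j `|` [set p].
Proof.
apply/seteqP; split=> [_ [y _ <-]|y Yy]; first exact: set_valP.
by exists (SigSub (mem_set Yy)).
Qed.

Lemma cech_complete_adjoin_point :
  Gdelta (range j `|` [set p]) -> cech_complete R adjoin_point.
Proof.
by rewrite -range_val; apply: cech_complete_compactification.
Qed.

(** [mu] is defined through the Stone-Cech compactification of the extension;
    this computes it from any map [q] to the given compact space. The extension
    [G] of the inclusion satisfies [G \o F = q], and its fibre over [p] is
    reduced to [p]. *)
Lemma mu_adjoin_point (q : stone_cech R X -> K) :
  continuous q -> (forall x, q (stone_cech_in R x) = j x) ->
  mu R adjoin_point = q @^-1` [set p].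
Proof.
move=> cq qj.
have eY : embedding (set_val : adjoin_point -> K).
  exact: embedding_set_val.
have [G [cG Gin]] := stone_cech_universal R cK hK (embedding_continuous eY).
have <- : G \o @ext_map R X adjoin_point = q.
  apply: stone_cech_extension_unique => //.
    by move=> z; apply: continuous_comp; [exact: ext_map_continuous|exact: cG].
  by move=> x /=; rewrite ext_map_in qj Gin.
apply/seteqP; split=> z; rewrite /mu /=; first by move=> ->; rewrite Gin.
exact: (embedding_extension_fiber (s := Ypt) eY cG Gin).
Qed.

End AdjoinPoint.

(** * The image of the Cech-complete extensions *)

Lemma zero_set_mu (R : realType) (X : topologicalType)
    (f : stone_cech_remainder R X -> R) :
  locally_compact [set: X] -> hausdorff_space X -> continuous f ->
  f @^-1` [set 0] !=set0 ->
  exists2 Y : one_point_extension X, cech_complete R Y &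
    mu R Y = set_val @` (f @^-1` [set 0]).
Proof.
move=> X_lc X_hausdorff cf [z0 fz0].
set Z : set (stone_cech R X) := set_val @` _.
have tX : tychonoff_space X.
  by split=> //; exact: (@locally_compact_completely_regular X R).
have cB := @stone_cech_compact R X; have hB := @stone_cech_hausdorff R X.
have cT : compact [set: stone_cech_remainder R X].
  exact/compact_set_type/stone_cech_remainder_compact.
have compact_val (C : set (stone_cech_remainder R X)) :
    closed C -> compact (set_val @` C).
  move=> clC; apply: continuous_compact; last exact: subclosed_compact clC cT _.
  by apply: continuous_subspaceT; exact: initial_continuous.
have clZ : closed Z.
  apply: compact_closed => //; apply: compact_val.
  apply: preimage_closed => [z _|]; first exact: cf.
  exact: closed_eq.
have XZ : range (stone_cech_in R) `<=` ~` Z.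
  move=> z Xz [w _ wz].
  have : (stone_cech_remainder R X) (set_val w) := set_valP w.
  by rewrite wz.
have ein := stone_cech_in_embedding R tX.
pose q := @pinch _ Z; have cq : continuous q by exact: pinch_continuous.
have hK := pinched_hausdorff cB hB clZ.
have cK := @pinched_compact _ Z.
have ej : embedding (q \o stone_cech_in R) by exact: pinch_embedding.
(* X avoids Z, and Z lies in the closure of X; [q] carries both facts to K. *)
have jp : ~ range (q \o stone_cech_in R) None.
  by move=> [x _ /pinch_None]; apply: XZ; exists x.
have clp : closure (range (q \o stone_cech_in R)) None.
  have [z Zz] : Z !=set0 by exists (set_val z0); exists z0.
  move=> V VN; have : nbhs z (q @^-1` V).
    by apply: cq; have -> : q z = None by apply/pinch_None.
  rewrite nbhsE => -[W [oW Wz] WV].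
  have [||_ [/[swap] -[x _ <-] Wx]] := @stone_cech_in_dense R X W => //.
    by exists z.
  by exists (q (stone_cech_in R x)); split; [exists x|exact: WV].
exists (adjoin_point R cK hK ej jp clp).
  apply: cech_complete_adjoin_point.
  rewrite -(image_comp (stone_cech_in R) q).
  pose C n := [set z : stone_cech_remainder R X | n.+1%:R^-1 <= `|f z|].
  apply: (pinch_Gdelta cB hB clZ (C := fun n => set_val @` C n)).
    move=> n; apply: compact_val.
    apply: (@preimage_closed _ _ (fun z => `|f z|) [set r | n.+1%:R^-1 <= r]).
      by move=> z _; apply: (@cvg_norm _ _ _ (nbhs z) _ f); exact: (cf z).
    exact: closed_ge.
  apply/seteqP; split=> [z /not_orP[nX nZ]|_ [n _ [z fz <-]]].
    pose w := SigSub (mem_set (nX : stone_cech_remainder R X z)).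
    have fw : 0 < `|f w|.
      by rewrite normr_gt0; apply/eqP => fw0; apply: nZ; exists w.
    have [n _ /(_ n (leqnn n)) /ltW] := near_infty_natSinv_lt (PosNum fw).
    by exists n => //; exists w.
  case; first exact: (set_valP z).
  move=> [w fw0 /val_inj wz]; move: fz; rewrite -wz /C /= fw0 normr0.
  by rewrite leNgt invr_gt0 ltr0n.
rewrite (mu_adjoin_point cK hK ej jp clp cq) //.
by apply/seteqP; split=> z; rewrite /= /q pinch_None.
Qed.

Theorem theorem2p4 (R : realType) (X : topologicalType)
    (X_lc : locally_compact [set: X]) (X_hausdorff : hausdorff_space X) :
  mu_image R X (cech_complete_extension R X) =
  [set (set_val @` Z : set (stone_cech R X))
     | Z in zero_sets R (stone_cech_remainder R X)] `\` [set set0].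
Proof.
apply/seteqP; split=> [_ [Y cY <-]|_ [[_ [f cf <-] <-] Z0]].
  split; last by move=> mu0; have := mu_neq0 R Y; rewrite mu0 => -[].
  exists (set_val @^-1` mu R Y); first exact: mu_zero_set.
  apply/seteqP; split=> [_ [z ? <-]//|z muz].
  by exists (SigSub (mem_set (mu_remainder muz))).
have [|Y cY muY] := zero_set_mu X_lc X_hausdorff cf.
  by have [_ [z fz _]] : (set_val @` (f @^-1` [set 0])) !=set0;
    [exact/set0P/eqP|exists z].
by exists Y.
Qed.
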